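(* Let $N\in\mathbb{N}$ be squarefree, $d\mid N$, $k\in\mathbb{Z}$, $\varepsilon\in\{1,-1\}$ and $f\in\mathcal{M}^*_k(\Sigma_N)$. Then the following assertions are equivalent: (i) $f(Z[V_d^{tr}])=\varepsilon f(Z)$ for all $Z\in\mathbb{H}_2$; (ii) $\alpha_f(T[V_d^{-1}])=\varepsilon\,\alpha_f(T)$ for all $T$; (iii) $\alpha_f(n,r,N)=\varepsilon\,\alpha_f(n',r',N)$ for all $n,n'\in\mathbb{N}_0$, $r,r'\in\mathbb{Z}$ with $4nN-r^2=4n'N-r'^2$, $r\equiv -r'\pmod{2d}$ and $r\equiv r'\pmod{2N/d}$.
   Context: Let $\mathbb{H}_2=\{Z=\begin{pmatrix}\tau&z\\ z&\tau'\end{pmatrix}\in\mathbb{C}^{2\times2}:\ Z=Z^{tr},\ \operatorname{Im}Z>0\}$, $\operatorname{Sp}_2(\mathbb{R})=\{M\in\mathbb{R}^{4\times4}: M^{tr}JM=J\}$, $J=\begin{pmatrix}0&-I\\ I&0\end{pmatrix}$, and for $M=\begin{pmatrix}A&B\\ C&D\end{pmatrix}$, $(f|_kM)(Z)=\det(CZ+D)^{-k}f((AZ+B)(CZ+D)^{-1})$. For $N\in\mathbb{N}$ the paramodular group $\Sigma_N$ consists of all $M\in\operatorname{Sp}_2(\mathbb{Q})$ of the form $\begin{pmatrix} * & *N & * & * \\ * & * & * & */N \\ * & *N & * & * \\ *N & *N & *N & * \end{pmatrix}$, $*\in\mathbb{Z}$. $\mathcal{M}_k(\Sigma_N)$: holomorphic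 $f:\mathbb{H}_2\to\mathbb{C}$ with $f|_kM=f$ for all $M\in\Sigma_N$; Fourier expansion $f(Z)=\sum_T\alpha_f(T)e^{2\pi i\operatorname{tr}(TZ)}$ over $T=\begin{pmatrix}n&r/2\\ r/2&mN\end{pmatrix}$, $n,m\in\mathbb{N}_0$, $r\in\mathbb{Z}$, $4nmN-r^2\ge0$; $\alpha_f(n,r,mN):=\alpha_f(T)$ (zero if $n,r$ or $m$ non-integral). Maaß space $\mathcal{M}^*_k(\Sigma_N)$: the $f\in\mathcal{M}_k(\Sigma_N)$ with $\alpha_f(n,r,mN)=\sum_{\delta\mid\gcd(n,r,m)}\delta^{k-1}\alpha_f(nm/\delta^2,r/\delta,N)$ for all $T\ne0$. For squarefree $N$ and $d\mid N$ fix integers $\alpha,\beta,\gamma,\delta$ with $\alpha\delta d-\beta\gamma N/d=1$ and put $V_d=\frac1{\sqrt d}\begin{pmatrix}\alpha d&\beta N\\ \gamma&\delta d\end{pmatrix}\in SL_2(\mathbb{R})$. Notation: $Z[V]=V^{tr}ZV$, so $Z[V_d^{tr}]=V_dZV_d^{tr}$ and $T[V_d^{-1}]=(V_d^{-1})^{tr}TV_d^{-1}$.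
   Formalization: The case k = 0, ε = −1 is excluded: there f = 1 lies in the Maaß space and satisfies (iii), since α_f(n,r,N) = 0 always, but not (i) or (ii); in weight 0 only f = 0 would satisfy the equivalence with ε = −1. *)

(* Defs.v *)
From mathcomp Require Export all_boot all_order all_algebra.
From mathcomp Require Export complex.
From mathcomp Require Export all_classical all_reals all_analysis.
From mathcomp.analysis.showcase Require summability.

Set Implicit Arguments.
Unset Strict Implicit.
Unset Printing Implicit Defensive.

Export Order.TTheory GRing.Theory Num.Theory.
Export numFieldNormedType.Exports.

Local Open Scope classical_set_scope.
Local Open Scope ring_scope.
Local Open Scope complex_scope.

Definition squarefree (n : nat) : Prop := forall e : nat, (e ^ 2 %| n)%N -> e = 1%N.

Definition mx_of_seq (F : nmodType) (p q : nat) (s : seq (seq F)) : 'M[F]_(p, q) :=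
  \matrix_(i < p, j < q) nth 0 (nth [::] s i) j.

(* [bracket X V] is X[V]. *)
Definition bracket (F : pzRingType) (X V : 'M[F]_2) : 'M[F]_2 := V^T *m X *m V.

Definition complex_mx (R : rcfType) (p q : nat) (A : 'M[R]_(p, q)) : 'M[R[i]]_(p, q) :=
  map_mx (fun x => x%:C) A.

Definition cexp (R : realType) (z : R[i]) : R[i] :=
  (expR (complex.Re z))%:C * (cos (complex.Im z) +i* sin (complex.Im z)).

Definition pos_def (R : realType) (Y : 'M[R]_2) : Prop :=
  forall v : 'cV[R]_2, v != 0 -> 0 < (v^T *m Y *m v) ord0 ord0.

Definition siegel_half_space (R : realType) : set 'M[R[i]]_2 :=
  [set Z | Z^T = Z /\ pos_def (map_mx (@complex.Im R) Z)].

(* The chart (tau, z, tau') |-> [[tau, z]; [z, tau']] identifies C^3 with the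
   complex symmetric matrices, in which the half-space is open. *)
Definition sym_mx (R : realType) (w : 'rV[R[i]]_3) : 'M[R[i]]_2 :=
  let c (i : nat) := w ord0 (inord i) in
  mx_of_seq 2 2 [:: [:: c 0; c 1]; [:: c 1; c 2]]%N.

(* Frechet differentiability over the field R[i]; the alias ^o carries the norm. *)
Definition holomorphic (R : realType) (f : 'M[R[i]]_2 -> R[i]) : Prop :=
  forall w : 'rV[(R[i])^o]_3, siegel_half_space (sym_mx w) ->
    differentiable (fun x : 'rV[(R[i])^o]_3 => (f (sym_mx x) : (R[i])^o)) w.

Definition symplectic (F : pzRingType) (M : 'M[F]_(2 + 2)) : Prop :=
  let J : 'M[F]_(2 + 2) := block_mx 0 (- 1%:M) 1%:M 0 in M^T *m J *m M = J.

Definition paramodular_shape (N : nat) : 'M[rat]_(2 + 2) :=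
  mx_of_seq (2 + 2) (2 + 2)
    [:: [:: 1;    N%:R; 1;    1      ];
        [:: 1;    1;    1;    N%:R^-1];
        [:: 1;    N%:R; 1;    1      ];
        [:: N%:R; N%:R; N%:R; 1      ]].

Definition paramodular_group (N : nat) : set 'M[rat]_(2 + 2) :=
  [set M | symplectic M /\
     forall i j, exists x : int, M i j = x%:~R * paramodular_shape N i j].

Definition slash (R : realType) (k : int) (f : 'M[R[i]]_2 -> R[i])
    (M : 'M[rat]_(2 + 2)) (Z : 'M[R[i]]_2) : R[i] :=
  let M' : 'M[R[i]]_(2 + 2) := map_mx ratr M in
  let num := ulsubmx M' *m Z + ursubmx M' in
  let den := dlsubmx M' *m Z + drsubmx M' in
  (\det den) ^ (- k) * f (num *m invmx den).

Definition quad_mx (R : realType) (n : nat) (r : int) (l : nat) : 'M[R]_2 :=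
  mx_of_seq 2 2 [:: [:: n%:R; r%:~R / 2]; [:: r%:~R / 2; l%:R]].

Definition fourier_index (R : realType) (N : nat) : set 'M[R]_2 :=
  [set T | exists (n m : nat) (r : int),
     0 <= 4 * n%:Z * m%:Z * N%:Z - r ^+ 2 /\ T = quad_mx R n r (m * N)].

(* Unordered convergence: limit of the finite partial sums along the directed
   set of finite sets of matrices, hence absolute convergence. *)
Definition fourier_expansion (R : realType) (N : nat) (f : 'M[R[i]]_2 -> R[i])
    (a : 'M[R]_2 -> R[i]) : Prop :=
  (forall T, ~ fourier_index N T -> a T = 0) /\
  (forall Z, siegel_half_space Z ->
     summability.partial_sum
       (fun T => a T * cexp ((2 * pi) *i * \tr (complex_mx T *m Z)))
       A @[A --> summability.totally] --> (f Z : (R[i])^o)).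

(* The Fourier expansion of a paramodular form is unique, so the choice below
   is the family alpha_f, extended by 0 to all real matrices. *)
Definition fourier_coef (R : realType) (N : nat) (f : 'M[R[i]]_2 -> R[i]) :
    'M[R]_2 -> R[i] :=
  xget (fun=> 0) [set a | fourier_expansion N f a].

(* The third conjunct follows from the first two, by periodicity and the
   Goetzky-Koecher principle. *)
Definition paramodular_form (R : realType) (N : nat) (k : int)
    (f : 'M[R[i]]_2 -> R[i]) : Prop :=
  [/\ holomorphic f,
      forall M, paramodular_group N M ->
        forall Z, siegel_half_space Z -> slash k f M Z = f Z
    & exists a, fourier_expansion N f a].

Definition maass_space (R : realType) (N : nat) (k : int)
    (f : 'M[R[i]]_2 -> R[i]) : Prop :=
  paramodular_form N k f /\
  forall (n m : nat) (r : int),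
    0 <= 4 * n%:Z * m%:Z * N%:Z - r ^+ 2 -> quad_mx R n r (m * N) != 0 ->
    fourier_coef N f (quad_mx R n r (m * N)) =
    \sum_(e <- divisors (gcdn (gcdn n `|r|%N) m))
      e%:R ^ (k - 1) *
      fourier_coef N f (quad_mx R ((n * m) %/ e ^ 2) (r %/ e)%Z N).

Definition atkin_lehner_mx (R : realType) (N d : nat) (al be ga de : int) : 'M[R]_2 :=
  (Num.sqrt d%:R)^-1 *:
  mx_of_seq 2 2 [:: [:: al%:~R * d%:R; be%:~R * N%:R];
                    [:: ga%:~R;        de%:~R * d%:R]].

(* Main.v *)
(* The terms of the Fourier expansion of [Z |-> f (V Z V^T)] are those of [f]
   reindexed by [T |-> V^T T V], so uniqueness of Fourier expansions gives
   (i) <-> (ii). Uniqueness needs no integration: averaging an absolutely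
   convergent expansion over finitely many translates of [Z] sums its
   coefficients over a residue class, and a suitable class isolates any given
   index up to a small tail.

   (ii) -> (iii): for [T' = (n', r', N)] the matrix [T'[V^-1]] has the same
   content 1 and discriminant, and middle entry [-r'] modulo [2d] and [r'] modulo
   [2N/d]. The Maass relation and invariance under [r |-> r + 2 lam N] (the case
   [d = 1] of the same substitution) then move it to [(n, r, N)].

   (iii) -> (ii): for [T <> 0] the two Maass sums agree term by term, as the
   substitution commutes with division by [delta]. For [T = 0] and [eps = -1],
   (iii) gives [alpha (0, 0, N) = 0], so every [alpha (n, 0, 0)] with [n > 0]
   vanishes by the Maass relation; the inversion [tau |-> -1/tau] then forces
   [alpha 0 = tau^k alpha 0], whence [alpha 0 = 0] as [k <> 0]. *)

Require Import Defs.
From mathcomp Require Import finmap.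
From mathcomp Require Import ring lra.
Import summability.

Set Implicit Arguments.
Unset Strict Implicit.
Unset Printing Implicit Defensive.

Local Open Scope classical_set_scope.
Local Open Scope ring_scope.
Local Open Scope complex_scope.

(** * Unordered sums *)

#[local] Existing Instance totally_filter.

(** For [K = R[i]] this is the mode of convergence demanded by [fourier_expansion], stated over an
    arbitrary index type. *)
Definition has_sum (K : numFieldType) (I : choiceType) (x : I -> K) (l : K) : Prop :=
  partial_sum x A @[A --> totally] --> (l : K^o).

Section HasSum.
Variables (K : numFieldType) (I : choiceType).
Implicit Types (x y : I -> K) (l m c : K) (A B : {fset I}).

Lemma partial_sumE x A : partial_sum x A = \sum_(i <- A) x i.
Proof. by rewrite (big_seq_fsetE _ A xpredT). Qed.

Lemma has_sumP x l : has_sum x l <->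
  forall e : K, 0 < e -> exists A, forall B, (A `<=` B)%fset ->
    `|l - \sum_(i <- B) x i| < e.
Proof.
split=> [/cvgrPdist_lt H e e0|H].
  have [A _ HA] := H e e0.
  by exists A => B AB; rewrite -partial_sumE; apply: HA.
apply/cvgrPdist_lt => e e0; have [A HA] := H e e0.
by exists A => // B AB /=; rewrite partial_sumE; apply: HA.
Qed.

Lemma has_sum_unique x l m : has_sum x l -> has_sum x m -> l = m.
Proof. exact: (@cvg_unique _ (@norm_hausdorff K K^o) _ _). Qed.

Lemma has_sumD x y l m :
  has_sum x l -> has_sum y m -> has_sum (fun i => x i + y i) (l + m).
Proof.
move=> hx hy; rewrite /has_sum.
have -> : partial_sum (fun i => x i + y i) = partial_sum x \+ partial_sum y.
  by apply/funext => A; rewrite /partial_sum big_split.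
exact: (@cvgD K K^o _ _ _ _ _ _ _ hx hy).
Qed.

Lemma has_sumZ c x l : has_sum x l -> has_sum (fun i => c * x i) (c * l).
Proof.
move=> hx; rewrite /has_sum.
have -> : partial_sum (fun i => c * x i) = (fun A => c *: (partial_sum x A : K^o)).
  by apply/funext => A; rewrite /partial_sum scaler_sumr.
exact: (@cvgZl_tmp K K^o _ _ _ _ _ _ hx).
Qed.

Lemma has_sum_sum (J : Type) (r : seq J) (x : J -> I -> K) (l : J -> K) :
  (forall j, has_sum (x j) (l j)) ->
  has_sum (fun i => \sum_(j <- r) x j i) (\sum_(j <- r) l j).
Proof.
move=> H; elim: r => [|j r IH].
  rewrite big_nil; under [X in has_sum X _]eq_fun do rewrite big_nil.
  apply/has_sumP => e e0; exists fset0 => B _.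
  by rewrite big1 ?subrr ?normr0.
rewrite big_cons; under [X in has_sum X _]eq_fun do rewrite big_cons.
exact: has_sumD.
Qed.

(* If [b i0] were nonzero, a set [S] avoiding the finitely many other indices
   which carry most of the sum would isolate it. *)
Lemma has_sum_isolate x l (i0 : I) : has_sum x l ->
  (forall A, exists S : pred I, [/\ S i0,
     has_sum (fun i => if S i then x i else 0) 0 &
     forall i, i \in A -> S i -> x i != 0 -> i = i0]) ->
  x i0 = 0.
Proof.
move=> /has_sumP hx hS; apply/eqP/negPn/negP => x0.
(* The estimates below end in [|x i0| < 3 * e], so dividing by 4 yields a contradiction. *)
pose e : K := `|x i0| / 4.
have e0 : 0 < e by rewrite divr_gt0 ?normr_gt0.
have [A HA] := hx e e0.
(* Cauchy criterion: the sums over [A] and over the union of [A] and [B] both lie within [e] of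
   [l]. *)
have tail B : [disjoint A & B]%fset -> `|\sum_(i <- B) x i| < 2 * e.
  move=> dAB.
  have h1 := HA A (fsubset_refl A); have h2 := HA _ (fsubsetUl A B).
  have UE : \sum_(i <- (A `|` B)%fset) x i = \sum_(i <- A) x i + \sum_(i <- B) x i.
    rewrite (big_fsetID _ [in A]) /=; congr (_ + _); apply: eq_fbigl => i.
      by rewrite !inE /= andbC; case: (i \in A).
    rewrite !inE /= andb_orl andbN /= andbC; case: (boolP (i \in A)) => //= iA.
    by apply/esym/negP => iB; move/fdisjointP: dAB => /(_ _ iA) /negP.
  rewrite UE in h2.
  rewrite -[X in `|X|](_ : (l - \sum_(i <- A) x i) -
     (l - (\sum_(i <- A) x i + \sum_(i <- B) x i)) = _); last by ring.
  by rewrite mulr2n mulrDl mul1r (le_lt_trans (ler_normB _ _)) ?ltrD.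
have [S [S0 /has_sumP hs SA]] := hS A.
have [C HC] := hs e e0.
pose D := (i0 |` (C `|` A))%fset.
(* Over [D] the sum restricted to [S] is [x i0] plus the sum over [B]: by [SA] the other members of
   [S] in [A] contribute zero. *)
pose B := [fset i in D | [&& S i, i \notin A & i != i0]]%fset.
have dB : [disjoint A & B]%fset.
  by apply/fdisjointP => i iA; rewrite !inE iA /= andbF andbF.
have CD : (C `<=` D)%fset by apply/fsubsetP => i iC; rewrite !inE iC orbT.
have := HC D CD; rewrite sub0r normrN.
have -> : \sum_(i <- D) (if S i then x i else 0) = x i0 + \sum_(i <- B) x i.
  rewrite (big_fsetD1 i0) ?fset1U1 //= S0; congr (_ + _).
  rewrite /B -big_fset_condE [RHS]big_mkcond [RHS](big_fsetD1 i0) ?fset1U1 //=.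
  rewrite eqxx !andbF add0r; apply: eq_big_seq => i; rewrite !inE => /andP[ii0 _].
  rewrite ii0 andbT; case: ifP => //= Si; case: ifP => // /negbFE iA.
  by apply/eqP/negPn/negP => /(SA _ iA Si)/eqP; apply/negP.
move=> h1; have h2 := tail _ dB.
have : `|x i0| < 3 * e.
  rewrite -[X in `|X|](addrK (\sum_(i <- B) x i)).
  rewrite (le_lt_trans (ler_normB _ _)) // (_ : 3 * e = e + 2 * e) ?ltrD //.
  by ring.
rewrite /e mulrCA -ltr_pdivrMl ?normr_gt0 // mulVf ?normr_eq0 //.
by rewrite ltr_pdivlMr // mul1r ltr_nat.
Qed.
End HasSum.

Lemma has_sum_reindex (K : numFieldType) (I J : choiceType) (g : J -> I)
    (h : I -> J) (x : I -> K) (l : K) :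
  cancel g h -> cancel h g -> has_sum x l -> has_sum (x \o g) l.
Proof.
move=> gK hK /has_sumP H; apply/has_sumP => e e0; have [A HA] := H e e0.
exists [fset h i | i in A]%fset => B AB.
have := HA [fset g j | j in B]%fset; rewrite big_imfset /=; last first.
  by move=> j j' _ _; exact: (can_inj gK).
apply; apply/fsubsetP => i iA; apply/imfsetP; exists (h i); last by rewrite hK.
by move/fsubsetP: AB; apply; apply/imfsetP; exists i.
Qed.

(** * Characters and residue classes *)

Section Characters.
Variable R : realType.
Implicit Types (t : R) (z w : R[i]).

Lemma mulcE (a b c d : R) :
  (a +i* b) * (c +i* d) = (a * c - b * d) +i* (a * d + b * c).
Proof. by []. Qed.

Lemma cexpE (a b : R) : cexp (a +i* b) = (expR a * cos b) +i* (expR a * sin b).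
Proof. by rewrite /cexp mulcE /= !mul0r subr0 addr0. Qed.

Lemma cexpD z w : cexp (z + w) = cexp z * cexp w.
Proof.
case: z w => [a b] [c d].
rewrite -[(a +i* b) + (c +i* d)]/((a + c) +i* (b + d)) !cexpE mulcE expRD cosD sinD.
by congr (_ +i* _); ring.
Qed.

Lemma cexp0 : cexp (0 : R[i]) = 1.
Proof. by rewrite /cexp /= expR0 cos0 sin0 mul1r. Qed.

Lemma cexp_neq0 z : cexp z != 0.
Proof.
apply/eqP => h; have := cexpD z (- z); rewrite subrr cexp0 h mul0r.
by apply/eqP; rewrite oner_eq0.
Qed.

(** The additive character e^(2 pi i t), trivial on the integers. *)
Definition chi t : R[i] := cexp ((2 * pi * t) *i).

Lemma chiD s t : chi (s + t) = chi s * chi t.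
Proof.
rewrite /chi -cexpD; congr cexp.
by rewrite -[RHS]/((0 + 0) +i* (_ + _)) addr0 mulrDr.
Qed.

Lemma chi0 : chi 0 = 1.
Proof. by rewrite /chi mulr0 cexp0. Qed.

Lemma chi_nat n t : chi (n%:R * t) = chi t ^+ n.
Proof.
elim: n => [|n IH]; first by rewrite mul0r chi0.
by rewrite exprS -IH -chiD -natr1 addrC mulrDl mul1r addrC.
Qed.

Lemma chi1 : chi 1 = 1.
Proof.
have -> : chi 1 = (cos (pi *+ 2) +i* sin (pi *+ 2)).
  by rewrite /chi cexpE expR0 !mul1r mulr1 mulr_natl.
by rewrite cos2pi sin2pi.
Qed.

Lemma chi_int (l : int) : chi l%:~R = 1.
Proof.
case: l => n; first by rewrite -[_%:~R]mulr1 chi_nat chi1 expr1n.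
have h : chi n.+1%:R = 1 by rewrite -[n.+1%:R]mulr1 chi_nat chi1 expr1n.
by rewrite -[LHS]mulr1 -{1}h -chiD NegzE mulrNz addNr chi0.
Qed.

(** The real part gives cos(2 pi t) = 1, hence sin(pi t) = 0 by the double angle formula, whereas
    the sine is positive on the open interval from 0 to pi. *)
Lemma chi_eq1 t : 0 <= t < 1 -> chi t = 1 -> t = 0.
Proof.
move=> /andP[t0 t1] /(congr1 (@complex.Re R)).
rewrite /chi cexpE expR0 mul1r /= => h.
apply/eqP; rewrite eq_le t0 andbT leNgt; apply/negP => tp.
have : 0 < sin (pi * t).
  apply: sin_gt0_pi; rewrite mulr_gt0 ?pi_gt0 //=.
  by rewrite -[X in _ < X]mulr1 ltr_pM2l ?pi_gt0.
have : cos ((pi * t) *+ 2) = 1 by rewrite -mulr_natl mulrA.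
rewrite cos_mulr2n; have := cos2Dsin2 (pi * t).
move: (cos _) (sin _) => c s; nra.
Qed.

Lemma chi_div_eq1 (l : int) (q : nat) : (0 < q)%N ->
  (chi (l%:~R / q%:R) == 1) = (q%:Z %| l)%Z.
Proof.
move=> q0; have qR : q%:R != 0 :> R by rewrite pnatr_eq0 -lt0n.
have E : l%:~R / q%:R = (l %/ q)%Z%:~R + (l %% q)%Z%:~R / q%:R :> R.
  rewrite {1}(divz_eq l q) rmorphD rmorphM /= mulrDl; congr (_ + _).
  by rewrite -mulrA divff ?mulr1.
rewrite E chiD chi_int mul1r; apply/eqP/dvdz_mod0P => [h|->]; last first.
  by rewrite mul0r chi0.
have q0' : (0 : R) < q%:R by rewrite ltr0n.
suff /eqP : (l %% q)%Z%:~R / q%:R = 0 :> R.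
  by rewrite mulf_eq0 invr_eq0 (negPf qR) orbF intr_eq0 => /eqP.
apply: chi_eq1 h; rewrite divr_ge0 ?ler0n ?ler0z ?modz_ge0 -?lt0n //=.
by rewrite ltr_pdivrMr // mul1r -[q%:R]/(q%:Z%:~R) ltr_int ltz_pmod.
Qed.

(** Orthogonality of characters: a geometric sum over the powers of a q-th root of unity. *)
Lemma sum_chi (l : int) (q : nat) : (0 < q)%N ->
  \sum_(j < q) chi (j%:R * (l%:~R / q%:R)) = if (q%:Z %| l)%Z then q%:R else 0.
Proof.
move=> q0; under eq_bigr do rewrite chi_nat.
have qR : q%:R != 0 :> R by rewrite pnatr_eq0 -lt0n.
rewrite -chi_div_eq1 //; case: eqP => [->|/eqP h].
  by under eq_bigr do rewrite expr1n; rewrite sumr_const card_ord.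
have : chi (l%:~R / q%:R) ^+ q - 1 = 0.
  by rewrite -chi_nat mulrCA divff ?mulr1 // chi_int subrr.
by rewrite subrX1 => /eqP; rewrite mulf_eq0 subr_eq0 (negPf h) => /eqP.
Qed.

(** Averaging the twisted sums against the conjugate characters of Z/q at [c] leaves exactly the
    terms whose label [L i] is congruent to [c]. *)
Lemma has_sum_residue_class (I : choiceType) (x : I -> R[i]) (L : I -> int)
    (q : nat) (c : int) : (0 < q)%N ->
  (forall j : nat, has_sum (fun i => x i * chi (j%:R * ((L i)%:~R / q%:R))) 0) ->
  has_sum (fun i => if (q%:Z %| L i - c)%Z then x i else 0) 0.
Proof.
move=> q0 H.
have qC : q%:R != 0 :> R[i] by rewrite pnatr_eq0 -lt0n.
have := @has_sum_sum _ _ _ (index_enum 'I_q) _ _ (fun j : 'I_q =>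
  @has_sumZ _ _ (q%:R^-1 * chi (- (j%:R * (c%:~R / q%:R)))) _ _ (H j)).
rewrite big1 => [|j _]; last by rewrite mulr0.
congr has_sum; apply/funext => i.
transitivity (\sum_(j < q) (q%:R^-1 * x i) * chi (j%:R * ((L i - c)%:~R / q%:R))).
  apply: eq_bigr => j _; rewrite rmorphB /= mulrBl mulrBr chiD; ring.
rewrite -mulr_sumr sum_chi //; case: ifP => _; last by rewrite mulr0.
by rewrite mulrAC mulVf ?mul1r.
Qed.

(** The form in which isolation is applied: the set [S] is a residue class of an integer label [L],
    and both [L] and the modulus may depend on the finite set [A]. *)
Lemma has_sum_separate (I : choiceType) (x : I -> R[i]) l (i0 : I) :
  has_sum x l ->
  (forall A : {fset I}, exists (q : nat) (L : I -> int), [/\ (0 < q)%N,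
     forall j : nat, has_sum (fun i => x i * chi (j%:R * ((L i)%:~R / q%:R))) 0 &
     forall i, i \in A -> x i != 0 -> (q%:Z %| L i - L i0)%Z -> i = i0]) ->
  x i0 = 0.
Proof.
move=> hx H; apply: (has_sum_isolate hx) => A.
have [q [L [q0 hL LA]]] := H A.
exists (fun i => (q%:Z %| L i - L i0)%Z); split.
- by rewrite subrr dvdz0.
- exact: has_sum_residue_class.
- by move=> i iA hi xi; apply: LA.
Qed.

End Characters.

(** * Uniqueness of Fourier expansions *)

Section TwoByTwo.
Variable F : comNzRingType.
Implicit Types (a b c d : F).

(** Convertible to the literal matrices in [quad_mx], [sym_mx] and [atkin_lehner_mx], so the
    entrywise rules below apply to them directly. *)
Definition mx2 a b c d : 'M[F]_2 := mx_of_seq 2 2 [:: [:: a; b]; [:: c; d]].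

Lemma mx2E (A : 'M[F]_2) : A = mx2 (A 0 0) (A 0 1) (A 1 0) (A 1 1).
Proof.
apply/matrixP => i j; rewrite mxE.
by case: i j => [[|[|//]] hi] [[|[|//]] hj] /=; congr (A _ _); apply: val_inj.
Qed.

Lemma eq_mx2 (A B : 'M[F]_2) :
  A 0 0 = B 0 0 -> A 0 1 = B 0 1 -> A 1 0 = B 1 0 -> A 1 1 = B 1 1 -> A = B.
Proof. by move=> h1 h2 h3 h4; rewrite (mx2E A) (mx2E B) h1 h2 h3 h4. Qed.

Lemma mulmx2E a b c d a' b' c' d' :
  mx2 a b c d *m mx2 a' b' c' d' =
  mx2 (a * a' + b * c') (a * b' + b * d') (c * a' + d * c') (c * b' + d * d').
Proof. by apply: eq_mx2; rewrite !mxE !big_ord_recl big_ord0 !mxE /= addr0. Qed.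

Lemma trmx2 a b c d : (mx2 a b c d)^T = mx2 a c b d.
Proof. by apply: eq_mx2; rewrite !mxE. Qed.

Lemma addmx2 a b c d a' b' c' d' :
  mx2 a b c d + mx2 a' b' c' d' = mx2 (a + a') (b + b') (c + c') (d + d').
Proof. by apply: eq_mx2; rewrite !mxE. Qed.

Lemma scalemx2 x a b c d : x *: mx2 a b c d = mx2 (x * a) (x * b) (x * c) (x * d).
Proof. by apply: eq_mx2; rewrite !mxE. Qed.

Lemma mx2_1 : mx2 1 0 0 1 = 1%:M.
Proof. by apply: eq_mx2; rewrite !mxE. Qed.

Lemma mx2_0 : mx2 0 0 0 0 = 0.
Proof. by apply: eq_mx2; rewrite !mxE. Qed.

Lemma mxtrace_mx2 a b c d : \tr (mx2 a b c d) = a + d.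
Proof. by rewrite /mxtrace !big_ord_recl big_ord0 !mxE /= addr0. Qed.

Lemma det_mx2E a b c d : \det (mx2 a b c d) = a * d - b * c.
Proof.
rewrite (expand_det_row _ 0) !big_ord_recl big_ord0 /cofactor !det_mx11 !mxE /=.
by rewrite addr0 expr0 expr1 mul1r mulN1r mulrN.
Qed.

Lemma mx2_inj a b c d a' b' c' d' :
  mx2 a b c d = mx2 a' b' c' d' -> [/\ a = a', b = b', c = c' & d = d'].
Proof.
by move=> /matrixP h; split;
  [have := h 0 0 | have := h 0 1 | have := h 1 0 | have := h 1 1]; rewrite !mxE.
Qed.

End TwoByTwo.

Lemma map_mx2 (F G : comNzRingType) (g : F -> G) a b c d :
  map_mx g (mx2 a b c d) = mx2 (g a) (g b) (g c) (g d).
Proof. by apply: eq_mx2; rewrite !mxE. Qed.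

Section Expansion.
Variable R : realType.
Implicit Types (T X : 'M[R]_2) (Z : 'M[R[i]]_2).

Definition fexp T Z : R[i] := cexp ((2 * pi) *i * \tr (complex_mx T *m Z)).

Lemma fourier_expansionE N f a : fourier_expansion N f a <->
  (forall T, ~ fourier_index N T -> a T = 0) /\
  (forall Z, siegel_half_space Z -> has_sum (fun T => a T * fexp T Z) (f Z)).
Proof. by []. Qed.

(** A real translation of [Z] only twists the term of [T] by a character, since the trace of
    [T *m X] is real. *)
Lemma fexp_shift T Z X :
  fexp T (Z + complex_mx X) = fexp T Z * chi (\tr (T *m X)).
Proof.
rewrite /fexp mulmxDr mxtraceD mulrDr cexpD; congr (_ * _); congr cexp.
have -> : complex_mx T *m complex_mx X = complex_mx (T *m X).
  by rewrite /complex_mx -(map_mxM (real_complex R)).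
have -> : \tr (complex_mx (T *m X)) = (\tr (T *m X))%:C.
  by rewrite -(trace_map_mx (real_complex R)).
by rewrite mulcE !mul0r mulr0 subr0 add0r.
Qed.

Lemma siegel_shift Z X : X^T = X -> siegel_half_space Z ->
  siegel_half_space (Z + complex_mx X).
Proof.
move=> hX [hZ hpos]; split.
  rewrite linearD /= hZ; congr (_ + _).
  by rewrite -{2}hX; apply/matrixP => i j; rewrite !mxE.
rewrite (_ : map_mx _ _ = map_mx (@complex.Im R) Z) //.
by apply/matrixP => i j; rewrite !mxE; case: (Z i j) => x y /=; rewrite addr0.
Qed.

Lemma siegel_diag (s t : R) : 0 < s -> 0 < t ->
  siegel_half_space (mx2 (s *i) 0 0 (t *i)).
Proof.
move=> s0 t0; split; first by rewrite trmx2.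
move=> v v0; rewrite map_mx2 /=.
have -> : (v^T *m mx2 s 0 0 t *m v) ord0 ord0 = s * v 0 0 ^+ 2 + t * v 1 0 ^+ 2.
  rewrite !mxE !big_ord_recl big_ord0 !mxE !big_ord_recl !big_ord0 !mxE /=.
  rewrite (_ : lift ord0 ord0 = 1); last exact: val_inj.
  ring.
have {v0} : (v 0 0 != 0) || (v 1 0 != 0).
  apply: contraNT v0; rewrite negb_or !negbK => /andP[/eqP h0 /eqP h1].
  apply/eqP/matrixP => i j; rewrite mxE (ord1 j).
  case: i => [[|[|//]] hi]; [rewrite -[RHS]h0|rewrite -[RHS]h1];
    by congr (v _ _); apply: val_inj.
case/orP => h.
  apply: ltr_pwDl; first by rewrite mulr_gt0 // exprn_even_gt0.
  by rewrite mulr_ge0 ?sqr_ge0 // ltW.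
apply: ltr_pwDr; first by rewrite mulr_gt0 // exprn_even_gt0.
by rewrite mulr_ge0 ?sqr_ge0 // ltW.
Qed.

(** The floors make the integers n, r, m total functions of a real matrix; they are exact at Fourier
    indices. *)
Definition idx_n T : int := Num.floor (T 0 0).
Definition idx_r T : int := Num.floor (2 * T 0 1).
Definition idx_m (N : nat) T : int := Num.floor (T 1 1 / N%:R).

Lemma fourier_indexE (N : nat) T : (0 < N)%N -> fourier_index N T ->
  T = mx2 (idx_n T)%:~R ((idx_r T)%:~R / 2) ((idx_r T)%:~R / 2)
          ((idx_m N T)%:~R * N%:R).
Proof.
move=> N0 [n [m [r [_ ->]]]].
have NR : N%:R != 0 :> R by rewrite pnatr_eq0 -lt0n.
rewrite /idx_n /idx_r /idx_m !mxE /= mulrCA divff // mulr1 natrM mulfK //.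
by rewrite -[n%:R]/(n%:Z%:~R) -[m%:R]/(m%:Z%:~R) !intrKfloor -natrM.
Qed.

Lemma fset_bound (I : choiceType) (A : {fset I}) (g : I -> nat) :
  exists K, (0 < K)%N /\ forall i, i \in A -> (g i < K)%N.
Proof.
exists (\sum_(i <- A) g i).+1; split=> // i iA; rewrite ltnS.
by rewrite (big_fsetD1 i iA) /= leq_addr.
Qed.

Lemma dvdz_small (K : nat) (x : int) : (K%:Z %| x)%Z -> (`|x| < K)%N -> x = 0.
Proof.
rewrite dvdzE /= => h1 h2; apply/eqP; rewrite -absz_eq0 -leqn0 leqNgt.
by apply/negP => /dvdn_leq/(_ h1); rewrite leqNgt h2.
Qed.

(* Translating [Z] by [j/q [[1, K]; [K, K^2/N]]] with [q = K^3] multiplies the term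
   of [T] by [chi (j L / q)], where [L = n + K r + K^2 m] determines [T] modulo [q]
   among finitely many [T] once [K] is large. *)
Lemma fourier_expansion0 (N : nat) (c : 'M[R]_2 -> R[i]) : (0 < N)%N ->
  (forall T, ~ fourier_index N T -> c T = 0) ->
  (forall Z, siegel_half_space Z -> has_sum (fun T => c T * fexp T Z) 0) ->
  forall T, c T = 0.
Proof.
move=> N0 supp hc T0; case: (pselect (fourier_index N T0)) => [iT0|/supp //].
have NR : N%:R != 0 :> R by rewrite pnatr_eq0 -lt0n.
pose Z0 : 'M[R[i]]_2 := mx2 (1 *i) 0 0 (1 *i).
have hZ0 : siegel_half_space Z0 by apply: siegel_diag; rewrite ltr01.
suff : c T0 * fexp T0 Z0 = 0.
  by move=> /eqP; rewrite mulf_eq0 (negPf (cexp_neq0 _)) orbF => /eqP.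
apply: (has_sum_separate (x := fun T => c T * fexp T Z0) (hc _ hZ0)) => A.
have [K [K0 HK]] := fset_bound A (fun T => `|idx_n T - idx_n T0| +
  `|idx_r T - idx_r T0| + `|idx_m N T - idx_m N T0|)%N.
exists (K ^ 3)%N, (fun T => idx_n T + K%:Z * (idx_r T + K%:Z * idx_m N T)).
split; first by rewrite expn_gt0 K0.
  move=> j; set q := (K ^ 3)%N.
  pose X : 'M[R]_2 := (j%:R / q%:R) *: mx2 1 K%:R K%:R (K%:R ^+ 2 / N%:R).
  have hX : X^T = X by rewrite /X scalemx2 trmx2.
  have := hc _ (siegel_shift hX hZ0); congr has_sum; apply/funext => T.
  case: (pselect (fourier_index N T)) => [iT|hT]; last by rewrite (supp T hT) !mul0r.
  rewrite fexp_shift mulrA; congr (_ * chi _).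
  rewrite {1}(fourier_indexE N0 iT) /X scalemx2 mulmx2E mxtrace_mx2.
  rewrite !(rmorphD, rmorphM) /=.
  have KR : K%:R != 0 :> R by rewrite pnatr_eq0 -lt0n.
  by rewrite -[K%:~R]/(K%:R); field; rewrite KR NR.
move=> T TA cT; have {cT} iT : fourier_index N T.
  by apply: contrapT => /supp h; rewrite h mul0r eqxx in cT.
set dn := idx_n T - idx_n T0; set dr := idx_r T - idx_r T0.
set dm := idx_m N T - idx_m N T0.
have := HK _ TA; rewrite -/dn -/dr -/dm => hb.
rewrite (_ : _ - _ = dn + K%:Z * (dr + K%:Z * dm)); last by rewrite /dn /dr /dm; ring.
rewrite (_ : (K ^ 3)%N%:Z = K%:Z * (K%:Z * K%:Z)); last first.
  by rewrite !expnS expn0 muln1 !PoszM.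
have KZ : K%:Z != 0 by rewrite -lt0n.
(* The three differences act as digits in base [K]: each is smaller than [K] in absolute value, so
   divisibility by [K ^ 3] kills them one after the other. *)
move=> hd; have dn0 : dn = 0.
  apply: (@dvdz_small K); last by apply: leq_ltn_trans hb; rewrite -addnA leq_addr.
  have := dvdz_trans (dvdz_mulr _ (dvdzz K%:Z)) hd.
  by rewrite rpredDr ?dvdz_mulr.
move: hd; rewrite dn0 add0r dvdz_mul2l // => hd.
have dr0 : dr = 0.
  apply: (@dvdz_small K); last first.
    by apply: leq_ltn_trans hb; rewrite addnAC leq_addl.
  have := dvdz_trans (dvdz_mulr _ (dvdzz K%:Z)) hd.
  by rewrite rpredDr ?dvdz_mulr.
move: hd; rewrite dr0 add0r dvdz_mul2l // => hd.
have dm0 : dm = 0.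
  by apply: (@dvdz_small K) => //; apply: leq_ltn_trans hb; rewrite leq_addl.
rewrite (fourier_indexE N0 iT) (fourier_indexE N0 iT0).
by move: dn0 dr0 dm0 => /subr0_eq-> /subr0_eq-> /subr0_eq->.
Qed.

(** The termwise difference is an expansion of 0. The factor [c] carries the sign of the theorem. *)
Lemma fourier_expansion_unique (N : nat) f g (a b : 'M[R]_2 -> R[i]) (c : R[i]) :
  (0 < N)%N -> fourier_expansion N f a -> fourier_expansion N g b ->
  (forall Z, siegel_half_space Z -> f Z = c * g Z) -> forall T, a T = c * b T.
Proof.
move=> N0 /fourier_expansionE[sa ha] /fourier_expansionE[sb hb] fg T.
apply/subr0_eq; apply: (fourier_expansion0 (c := fun T => a T - c * b T) N0).
  by move=> T' h; rewrite sa // sb // mulr0 subr0.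
move=> Z hZ; have := has_sumD (ha Z hZ) (has_sumZ (c := - c) (hb Z hZ)).
rewrite (fg Z hZ) mulNr subrr; congr has_sum; apply/funext => T'.
by rewrite mulrBl mulNr (mulrA c).
Qed.

Lemma fourier_coefP (N : nat) (f : 'M[R[i]]_2 -> R[i]) :
  (exists a, fourier_expansion N f a) -> fourier_expansion N f (fourier_coef N f).
Proof. by move=> h; rewrite /fourier_coef; exact: xgetPex. Qed.

End Expansion.

(** * Substitutions in the half-space *)

Section Bracket.
Variable R : realType.
Implicit Types (T V W : 'M[R]_2) (Z : 'M[R[i]]_2).

Lemma bracketM (F : comNzRingType) (X A B : 'M[F]_2) :
  bracket (bracket X A) B = bracket X (A *m B).
Proof. by rewrite /bracket trmx_mul !mulmxA. Qed.

Lemma bracket1 (F : comNzRingType) (X : 'M[F]_2) : bracket X 1%:M = X.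
Proof. by rewrite /bracket trmx1 mul1mx mulmx1. Qed.

Lemma bracketZ (F : comNzRingType) (X A : 'M[F]_2) c :
  bracket X (c *: A) = c ^+ 2 *: bracket X A.
Proof.
have trZ : (c *: A)^T = c *: A^T by apply/matrixP => i j; rewrite !mxE.
by rewrite /bracket trZ -!scalemxAl -scalemxAr scalerA.
Qed.

Lemma complex_mxM p q s (A : 'M[R]_(p, q)) (B : 'M[R]_(q, s)) :
  complex_mx (A *m B) = complex_mx A *m complex_mx B.
Proof. exact: (map_mxM (real_complex R)). Qed.

Lemma complex_mxT p q (A : 'M[R]_(p, q)) : complex_mx A^T = (complex_mx A)^T.
Proof. by apply/matrixP => i j; rewrite !mxE. Qed.

Lemma map_Im_mulmxl p q s (A : 'M[R]_(p, q)) (Z : 'M[R[i]]_(q, s)) :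
  map_mx (@complex.Im R) (complex_mx A *m Z) = A *m map_mx (@complex.Im R) Z.
Proof.
apply/matrixP => i j; rewrite !mxE.
rewrite (raddf_sum (@complex.Im R : Rcomplex R -> R)); apply: eq_bigr => l _.
by rewrite !mxE; case: (Z l j) => x y; rewrite /= mul0r addr0.
Qed.

Lemma map_Im_mulmxr p q s (Z : 'M[R[i]]_(p, q)) (A : 'M[R]_(q, s)) :
  map_mx (@complex.Im R) (Z *m complex_mx A) = map_mx (@complex.Im R) Z *m A.
Proof.
rewrite -[LHS]trmxK -[RHS]trmxK trmx_mul; congr (_^T).
have <- : map_mx (@complex.Im R) (complex_mx A^T *m Z^T) =
    A^T *m (map_mx (@complex.Im R) Z)^T.
  rewrite map_Im_mulmxl; congr (_ *m _).
  by apply/matrixP => i j; rewrite !mxE.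
by rewrite complex_mxT -trmx_mul; apply/matrixP => i j; rewrite !mxE.
Qed.

(** For real [V], Im(V Z V^tr) = V (Im Z) V^tr, and v -> V^tr v is injective. *)
Lemma siegel_bracket V Z : V \in unitmx -> siegel_half_space Z ->
  siegel_half_space (bracket Z (complex_mx V)^T).
Proof.
move=> uV [hZ hpos]; rewrite /bracket trmxK; split.
  by rewrite !trmx_mul trmxK hZ mulmxA.
move=> v v0; rewrite -complex_mxT map_Im_mulmxr map_Im_mulmxl.
have := hpos (V^T *m v); rewrite trmx_mul trmxK !mulmxA; apply.
apply: contra v0 => /eqP h.
have uVT : V^T \in unitmx by rewrite unitmx_tr.
by rewrite -[v](mulKmx uVT) h mulmx0.
Qed.

(** Cyclicity of the trace. *)
Lemma fexp_bracket T V Z : fexp T (bracket Z (complex_mx V)^T) = fexp (bracket T V) Z.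
Proof.
congr (cexp (_ * _)); rewrite /bracket trmxK !complex_mxM complex_mxT !mulmxA.
by rewrite mxtrace_mulC !mulmxA.
Qed.

(** Reindexing by [T |-> bracket T W] gives Z -> f(V Z V^tr) the coefficients [a (bracket T W)]. One
    direction is then uniqueness of expansions, the other uniqueness of limits. It serves both V_d
    and, with [c = 1], the unipotent substitutions. *)
Lemma bracket_invariance (N : nat) (f : 'M[R[i]]_2 -> R[i]) (V W : 'M[R]_2)
    (c : R[i]) : (0 < N)%N ->
  (exists a, fourier_expansion N f a) -> V *m W = 1%:M ->
  (forall T, fourier_index N T -> fourier_index N (bracket T V)) ->
  (forall T, fourier_index N T -> fourier_index N (bracket T W)) ->
  (forall Z, siegel_half_space Z -> f (bracket Z (complex_mx V)^T) = c * f Z) <->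
  (forall T, fourier_index N T ->
     fourier_coef N f (bracket T W) = c * fourier_coef N f T).
Proof.
move=> N0 /fourier_coefP ef VW iV iW; set a := fourier_coef N f in ef *.
have [supp ha] := (fourier_expansionE N f a).1 ef.
have WV := mulmx1C VW.
have WK : cancel (fun T => bracket T W) (fun T => bracket T V).
  by move=> T; rewrite bracketM WV bracket1.
have VK : cancel (fun T => bracket T V) (fun T => bracket T W).
  by move=> T; rewrite bracketM VW bracket1.
have uV : V \in unitmx by have [] := mulmx1_unit VW.
have supp' T : ~ fourier_index N T -> a (bracket T W) = 0.
  by move=> h; apply: supp => /iV; rewrite WK.
have hs Z : siegel_half_space Z ->
    has_sum (fun T => a (bracket T W) * fexp T Z) (f (bracket Z (complex_mx V)^T)).
  move=> hZ; have := has_sum_reindex WK VK (ha _ (siegel_bracket uV hZ)).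
  by congr has_sum; apply/funext => T /=; rewrite fexp_bracket WK.
have ef' : fourier_expansion N (fun Z => f (bracket Z (complex_mx V)^T))
    (fun T => a (bracket T W)) by exact ((fourier_expansionE _ _ _).2 (conj supp' hs)).
split=> H; first by move=> T _; exact (fourier_expansion_unique N0 ef' ef H T).
move=> Z hZ; apply: has_sum_unique (hs Z hZ) _.
have := has_sumZ (c := c) (ha Z hZ); congr has_sum; apply/funext => T.
rewrite (mulrA c); case: (pselect (fourier_index N T)) => [/H -> //|hT].
by rewrite (supp T hT) (supp' T hT) mulr0.
Qed.

End Bracket.

(** * The Atkin-Lehner substitution on triples (n, r, m) *)

Section AtkinLehner.
Variables (R : realType) (d e : nat) (al be ga de : int).
Hypotheses (d0 : (0 < d)%N) (e0 : (0 < e)%N).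
Hypothesis hV : al * de * d%:Z - be * ga * e%:Z = 1.
Implicit Types (n r m : int).
Local Notation N := (d * e)%N.

(* [2 * quad_mx] is the Gram matrix of [n x^2 + r x y + m N y^2]; these are its
   coefficients after the substitution by [atkin_lehner_mx]. *)
Definition al_n n r m : int := al ^+ 2 * d%:Z * n + al * ga * r + ga ^+ 2 * e%:Z * m.
Definition al_r n r m : int :=
  2 * al * be * N%:Z * n + (al * de * d%:Z + be * ga * e%:Z) * r +
  2 * ga * de * N%:Z * m.
Definition al_m n r m : int := be ^+ 2 * e%:Z * n + be * de * r + de ^+ 2 * d%:Z * m.

(** The discriminant is multiplied by the square of the determinant, which is 1 by [hV]. *)
Lemma al_disc n r m :
  4 * al_n n r m * al_m n r m * N%:Z - al_r n r m ^+ 2 = 4 * n * m * N%:Z - r ^+ 2.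
Proof.
have -> : 4 * n * m * N%:Z - r ^+ 2 = (al * de * d%:Z - be * ga * e%:Z) ^+ 2 *
    (4 * n * m * N%:Z - r ^+ 2) by rewrite hV expr1n mul1r.
rewrite /al_n /al_m /al_r PoszM; ring.
Qed.

(** By [hV] the coefficient of r is 2 al de d - 1, and equally 2 be ga e + 1; the other two terms
    are divisible by 2N. This yields both congruences, here and for [al_r_mode]. *)
Lemma al_r_modd n r m : (al_r n r m = - r %[mod 2 * d%:Z])%Z.
Proof.
apply/eqP; rewrite eqz_mod_dvd; apply/dvdzP.
exists (al * be * e%:Z * n + al * de * r + ga * de * e%:Z * m).
rewrite /al_r (_ : be * ga * e%:Z = al * de * d%:Z - 1); last first.
  by rewrite -[in RHS]hV; ring.
by rewrite PoszM; ring.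
Qed.

Lemma al_r_mode n r m : (al_r n r m = r %[mod 2 * e%:Z])%Z.
Proof.
apply/eqP; rewrite eqz_mod_dvd; apply/dvdzP.
exists (al * be * d%:Z * n + be * ga * r + ga * de * d%:Z * m).
rewrite /al_r (_ : al * de * d%:Z = 1 + be * ga * e%:Z); last first.
  by rewrite -[in RHS]hV; ring.
by rewrite PoszM; ring.
Qed.

Lemma atkin_lehnerE : atkin_lehner_mx R N d al be ga de =
  (Num.sqrt d%:R)^-1 *: mx2 (al%:~R * d%:R) (be%:~R * N%:R) ga%:~R (de%:~R * d%:R).
Proof. by []. Qed.

(** The two factors 1/sqrt(d) combine to 1/d, which every entry absorbs; this is why the new
    coefficients are integral. *)
Lemma al_bracket n r m :
  bracket (mx2 n%:~R (r%:~R / 2) (r%:~R / 2) (m%:~R * N%:R))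
    (atkin_lehner_mx R N d al be ga de) =
  mx2 (al_n n r m)%:~R ((al_r n r m)%:~R / 2) ((al_r n r m)%:~R / 2)
    ((al_m n r m)%:~R * N%:R).
Proof.
have dR : d%:R != 0 :> R by rewrite pnatr_eq0 -lt0n.
have E : (Num.sqrt d%:R)^-1 * (Num.sqrt d%:R)^-1 = d%:R^-1 :> R.
  by rewrite -invfM -expr2 sqr_sqrtr ?ler0n.
rewrite atkin_lehnerE bracketZ expr2 E /bracket trmx2 !mulmx2E scalemx2.
rewrite /al_n /al_r /al_m natrM PoszM.
rewrite !(rmorphD, rmorphM, rmorphXn) /= -[d%:~R]/(d%:R) -[e%:~R]/(e%:R).
by congr mx2; field.
Qed.

End AtkinLehner.

(** The inverse is the adjugate. It has the same shape with parameters [de, - be, - ga, al], so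
    results on V_d also hold for its inverse. *)
Lemma atkin_lehnerK (R : realType) (d e : nat) (al be ga de : int) : (0 < d)%N ->
  al * de * d%:Z - be * ga * e%:Z = 1 ->
  atkin_lehner_mx R (d * e) d al be ga de *m
    atkin_lehner_mx R (d * e) d de (- be) (- ga) al = 1%:M.
Proof.
move=> d0 hV; have dR : d%:R != 0 :> R by rewrite pnatr_eq0 -lt0n.
have E : (Num.sqrt d%:R)^-1 * (Num.sqrt d%:R)^-1 = d%:R^-1 :> R.
  by rewrite -invfM -expr2 sqr_sqrtr ?ler0n.
rewrite !atkin_lehnerE -scalemxAl -scalemxAr scalerA E mulmx2E scalemx2 -mx2_1.
have hR : al%:~R * de%:~R * d%:R - be%:~R * ga%:~R * e%:R = 1 :> R.
  by have := congr1 (fun x : int => x%:~R : R) hV; rewrite !(rmorphB, rmorphM).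
rewrite natrM !rmorphN /=; congr mx2.
- by rewrite -[RHS]hR; field.
- by field.
- by field.
- by rewrite -[RHS]hR; field.
Qed.

(** * Paramodular transformations *)

Section Paramodular.

(** Three equations suffice: the remaining block of M^tr J M is minus the transpose of the opposite
    one. *)
Lemma symplectic_block (a b c d a' b' c' d' x y z t x' y' z' t' : rat) :
  let A := mx2 a b c d in let B := mx2 x y z t in
  let C := mx2 x' y' z' t' in let D := mx2 a' b' c' d' in
  C^T *m A - A^T *m C = 0 -> D^T *m B - B^T *m D = 0 ->
  D^T *m A - B^T *m C = 1%:M ->
  symplectic (block_mx A B C D).
Proof.
move=> A B C D hAC hBD hAD.
have hAD' : A^T *m D - C^T *m B = 1%:M.
  by rewrite -[RHS]trmx1 -hAD linearB /= !trmx_mul !trmxK.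
rewrite /symplectic tr_block_mx mulmx_block !mulmx0 !mulmx1 !mulmxN !mulmx1.
rewrite !add0r !addr0 mulmx_block; congr block_mx.
- by rewrite mulNmx.
- by rewrite mulNmx -[RHS]opprK opprK -hAD' opprB addrC.
- by rewrite mulNmx.
- by rewrite mulNmx.
Qed.

Lemma paramodular_block (N : nat) (A B C D : 'M[rat]_2) :
  symplectic (block_mx A B C D) ->
  (forall i j : 'I_2, [/\
     exists x : int, A i j = x%:~R * paramodular_shape N (lshift 2 i) (lshift 2 j),
     exists x : int, B i j = x%:~R * paramodular_shape N (lshift 2 i) (rshift 2 j),
     exists x : int, C i j = x%:~R * paramodular_shape N (rshift 2 i) (lshift 2 j) &
     exists x : int, D i j = x%:~R * paramodular_shape N (rshift 2 i) (rshift 2 j)]) ->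
  paramodular_group N (block_mx A B C D).
Proof.
move=> hS h; split=> // i j.
case: (split_ordP i) => i' ->; case: (split_ordP j) => j' ->;
  rewrite ?block_mxEul ?block_mxEur ?block_mxEdl ?block_mxEdr; by case: (h i' j').
Qed.

(** The block matrix diag(U, U^-tr) with U = [[1, 0], [lam, 1]], acting by Z -> U Z U^tr. *)
Lemma paramodular_translation (N : nat) (lam : int) :
  paramodular_group N
    (block_mx (mx2 1 0 lam%:~R 1) (mx2 0 0 0 0) (mx2 0 0 0 0) (mx2 1 (- lam%:~R) 0 1)).
Proof.
apply: paramodular_block.
  apply: symplectic_block; rewrite !trmx2 !mulmx2E -?mx2_1 -?mx2_0;
    apply: eq_mx2; rewrite !mxE /=; ring.
move=> i j; case: i j => [[|[|//]] hi] [[|[|//]] hj]; split; rewrite !mxE /=;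
  by [exists 0; rewrite mul0r | exists 1; rewrite mul1r | exists lam; rewrite mulr1 |
      exists (- lam); rewrite mulr1 rmorphN].
Qed.

(** The inversion of SL_2 embedded in the first variable: on diagonal [Z] it is tau -> -1/tau with
    tau' fixed, and det(CZ + D) = tau. *)
Lemma paramodular_inversion (N : nat) :
  paramodular_group N
    (block_mx (mx2 0 0 0 1) (mx2 (-1) 0 0 0) (mx2 1 0 0 0) (mx2 0 0 0 1)).
Proof.
apply: paramodular_block.
  apply: symplectic_block; rewrite !trmx2 !mulmx2E -?mx2_1 -?mx2_0;
    apply: eq_mx2; rewrite !mxE /=; ring.
move=> i j; case: i j => [[|[|//]] hi] [[|[|//]] hj]; split; rewrite !mxE /=;
  by [exists 0; rewrite mul0r | exists 1; rewrite mul1r | exists (-1); rewrite mulr1].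
Qed.

Variable R : realType.
Implicit Types (f : 'M[R[i]]_2 -> R[i]).

Lemma slash_block k f (A B C D : 'M[rat]_2) Z :
  slash k f (block_mx A B C D) Z =
  let q : 'M[rat]_2 -> 'M[R[i]]_2 := map_mx ratr in
  \det (q C *m Z + q D) ^ (- k) * f ((q A *m Z + q B) *m invmx (q C *m Z + q D)).
Proof.
by rewrite /slash map_block_mx block_mxKul block_mxKur block_mxKdl block_mxKdr.
Qed.

Lemma invmx_right (n : nat) (F : comUnitRingType) (A B : 'M[F]_n) :
  A *m B = 1%:M -> invmx A = B.
Proof.
by move=> AB; have [uA _] := mulmx1_unit AB; rewrite -[LHS]mulmx1 -AB mulKmx.
Qed.

Lemma paramodular_form_translation N k f (lam : int) Z : paramodular_form N k f ->
  siegel_half_space Z ->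
  f (bracket Z (complex_mx (mx2 1 0 lam%:~R 1))^T) = f Z.
Proof.
move=> [_ hf _] hZ; rewrite -[RHS](hf _ (paramodular_translation N lam) _ hZ).
rewrite slash_block /= !map_mx2 !rmorphN !rmorph0 !rmorph1 !ratr_int mx2_0.
rewrite mul0mx add0r addr0 det_mx2E mulr0 subr0 mulr1 exp1rz mul1r; congr f.
rewrite (@invmx_right _ _ _ (mx2 1 lam%:~R 0 1)); last first.
  by rewrite mulmx2E -mx2_1; apply: eq_mx2; rewrite !mxE /=; ring.
rewrite /bracket trmxK; congr (_ *m _ *m _).
  by rewrite /complex_mx map_mx2 !rmorph0 !rmorph1 rmorph_int.
by rewrite /complex_mx map_mx2 trmx2 !rmorph0 !rmorph1 rmorph_int.
Qed.

Lemma paramodular_form_inversion N k f (t t' : R[i]) : paramodular_form N k f ->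
  t != 0 -> siegel_half_space (mx2 t 0 0 t') ->
  f (mx2 (- t^-1) 0 0 t') = t ^ k * f (mx2 t 0 0 t').
Proof.
move=> [_ hf _] t0 hZ; rewrite -[in RHS](hf _ (paramodular_inversion N) _ hZ).
rewrite slash_block /= !map_mx2 !rmorphN !rmorph0 !rmorph1 !mulmx2E !addmx2.
rewrite !(mul0r, mul1r, mulr0, add0r, addr0) det_mx2E mulr1 mulr0 subr0.
rewrite mulrA -expfzDr // subrr expr0z mul1r; congr f.
rewrite (@invmx_right _ _ _ (mx2 t^-1 0 0 1)); last first.
  by rewrite mulmx2E -mx2_1; apply: eq_mx2; rewrite !mxE /= ?mulfV //; ring.
by rewrite mulmx2E; apply: eq_mx2; rewrite !mxE /=; ring.
Qed.

End Paramodular.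

(** * The constant term and integral substitutions *)

Section Reduction.
Variable R : realType.
Implicit Types (f : 'M[R[i]]_2 -> R[i]).

Lemma fexp_0 (Z : 'M[R[i]]_2) : fexp 0 Z = 1.
Proof.
rewrite /fexp (_ : complex_mx 0 = 0) ?mul0mx ?mxtrace0 ?mulr0 ?cexp0 //.
by apply/matrixP => i j; rewrite !mxE.
Qed.

Lemma quad_mxE n r m (N : nat) : quad_mx R n r (m * N) =
  mx2 n%:Z%:~R (r%:~R / 2) (r%:~R / 2) (m%:Z%:~R * N%:R).
Proof. by rewrite -[n%:Z%:~R]/(n%:R) -[m%:Z%:~R]/(m%:R) -natrM. Qed.

Lemma quad_mx_inj n r m n' r' m' :
  quad_mx R n r m = quad_mx R n' r' m' -> [/\ n = n', r = r' & m = m'].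
Proof.
move=> /mx2_inj[/eqP hn hr _ /eqP hm]; move: hn hm; rewrite !eqr_nat => /eqP-> /eqP->.
by split=> //; apply: (@intr_inj R); apply: (mulIf _ hr); rewrite invr_eq0 pnatr_eq0.
Qed.

Lemma quad_mx0 : quad_mx R 0 0 0 = 0.
Proof. by rewrite -mx2_0 /quad_mx mul0r. Qed.

Lemma fourier_index_quad (N n m : nat) (r : int) : (0 < N)%N ->
  fourier_index N (quad_mx R n r (m * N)) -> 0 <= 4 * n%:Z * m%:Z * N%:Z - r ^+ 2.
Proof.
move=> N0 [n' [m' [r' [h /quad_mx_inj[-> -> /eqP]]]]].
by rewrite eqn_pmul2r // => /eqP->.
Qed.

(** As (2i)^4 = 16, the equation (2i)^k = 1 would give 16^k = 1. *)
Lemma exprz_2i_neq1 (k : int) : k != 0 -> (2 *i : R[i]) ^ k != 1.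
Proof.
move=> k0; apply: contra k0 => /eqP h.
have h4 : (2 *i : R[i]) ^+ 4 = 16.
  have h2 : (2 *i : R[i]) ^+ 2 = - 4.
    by apply/eqP; rewrite expr2 eq_complex /=; apply/andP; split; apply/eqP; ring.
  by rewrite (exprM _ 2 2) h2; ring.
have h16 : ((16 : R) ^ k)%:C = 1.
  rewrite (fmorphXz (real_complex R)) rmorph_nat -h4.
  by rewrite -[(2 *i) ^+ 4]/((2 *i) ^ 4%:Z) exprzAC h exp1rz.
have {h16} h16 : (16 : R) ^ k = 16 ^ 0 by rewrite expr0z; apply: complexI.
apply/eqP; apply: ieexprIz h16; first by rewrite ltr0n.
by rewrite (eqr_nat R 16 1).
Qed.

(* If only [T = 0] has [m = 0], comparing the expansions at [-1/tau] and [tau]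
   as series in [tau'] gives [alpha(0) (1 - tau^k) = 0]; we take [tau = 2i]. *)
Lemma constant_term_eq0 N k f : (0 < N)%N -> paramodular_form N k f -> k != 0 ->
  (forall n, (0 < n)%N -> fourier_coef N f (quad_mx R n 0 0) = 0) ->
  fourier_coef N f 0 = 0.
Proof.
move=> N0 hf k0 h0; have [_ _ /fourier_coefP ef] := hf.
have NR : N%:R != 0 :> R by rewrite pnatr_eq0 -lt0n.
set a := fourier_coef N f in h0 ef *.
have [supp ha] := (fourier_expansionE N f a).1 ef.
pose t : R[i] := 2 *i.
have t0 : t != 0.
  by apply/eqP => /(congr1 (@complex.Im R))/eqP; rewrite /= pnatr_eq0.
have tV : - t^-1 = (2^-1) *i.
  apply: (mulIf t0); rewrite mulNr mulVf // mulcE; apply/eqP; rewrite eq_complex /=.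
  by rewrite !mul0r mulr0 addr0 sub0r mulVf ?pnatr_eq0 // oppr0 !eqxx.
pose Z1 : 'M[R[i]]_2 := mx2 (- t^-1) 0 0 (1 *i).
pose Z2 : 'M[R[i]]_2 := mx2 t 0 0 (1 *i).
have hZ1 : siegel_half_space Z1.
  by rewrite /Z1 tV; apply: siegel_diag; rewrite ?invr_gt0 ?ltr0n ?ltr01.
have hZ2 : siegel_half_space Z2 by apply: siegel_diag; rewrite ?ltr0n ?ltr01.
pose X (x : R) : 'M[R]_2 := mx2 0 0 0 x.
have hX x : (X x)^T = X x by rewrite trmx2.
have cX x : complex_mx (X x) = mx2 0 0 0 x%:C by rewrite /complex_mx map_mx2.
(* The terms of f(-1/tau, tau') - tau^k f(tau, tau'), which is 0. Translating tau' by [x] twists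
   them by characters of [T 1 1] alone. *)
pose c T := a T * fexp T Z1 - t ^ k * (a T * fexp T Z2).
have suppc T : a T = 0 -> c T = 0.
  by rewrite /c => ->; rewrite (mul0r (fexp T Z1)) (mul0r (fexp T Z2)) mulr0 subr0.
have hc x : has_sum (fun T => c T * chi (T 1 1 * x)) 0.
  have h1 := ha _ (siegel_shift (hX x) hZ1).
  have h2 := ha _ (siegel_shift (hX x) hZ2).
  have := has_sumD h1 (has_sumZ (c := - t ^ k) h2).
  have -> : f (Z1 + complex_mx (X x)) = t ^ k * f (Z2 + complex_mx (X x)).
    have := siegel_shift (hX x) hZ2; rewrite cX !addmx2 !addr0.
    exact: (paramodular_form_inversion hf t0).
  rewrite mulNr subrr; congr has_sum; apply/funext => T.
  have trX : \tr (T *m X x) = T 1 1 * x.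
    by rewrite {1}(mx2E T) mulmx2E mxtrace_mx2 !mulr0 !add0r.
  rewrite !fexp_shift trX /c mulNr mulrBl.
  by rewrite (mulrA (a T)) -(mulrA (t ^ k)) (mulrA (a T) (fexp T Z2)).
suff : c 0 = 0.
  rewrite /c !fexp_0 !mulr1 -{1}[a 0]mul1r -mulrBl => /eqP.
  by rewrite mulf_eq0 subr_eq0 eq_sym (negPf (exprz_2i_neq1 k0)) => /eqP.
have hc0 : has_sum c 0.
  by have := hc 0; congr has_sum; apply/funext => T; rewrite mulr0 chi0 mulr1.
apply: (has_sum_separate hc0) => A.
have [K [K0 HK]] := fset_bound A (fun T => `|idx_m N T|%N).
exists K, (idx_m N); split=> //.
  (* At an index the entry [T 1 1] is m N, so a translation of tau' by j/(N K) is the twist by j m /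
     K. *)
  move=> j; have := hc (j%:R / (N%:R * K%:R)); congr has_sum; apply/funext => T.
  case: (pselect (fourier_index N T)) => [iT|hT].
    rewrite {2}(fourier_indexE N0 iT) mxE /=; congr (_ * chi _).
    have KR : K%:R != 0 :> R by rewrite pnatr_eq0 -lt0n.
    by field; rewrite KR NR.
  by rewrite (suppc T (supp T hT)) !mul0r.
move=> T TA cT.
have idx0 : idx_m N (0 : 'M[R]_2) = 0 by rewrite /idx_m mxE mul0r floor0.
rewrite idx0 subr0 => /dvdz_small/(_ (HK _ TA)) hm.
have iT : fourier_index N T.
  apply: contrapT => hT; move/eqP: cT; apply.
  by rewrite (suppc T (supp T hT)).
(* Here m = 0, so the discriminant condition forces r = 0; by [h0] only T = 0 survives among the (n,
   0, 0). *)
case: (iT) => n [m [r [hd hT]]].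
have m0 : m = 0%N.
  have /eqP := hm; rewrite /idx_m hT quad_mxE mxE /= mulfK // intrKfloor.
  by move=> /eqP[].
move: hd hT; rewrite m0 mulr0 mul0r sub0r oppr_ge0 => hr hT.
have r0 : r = 0 by apply/eqP; rewrite -sqrf_eq0 eq_le hr sqr_ge0.
move: hT; rewrite r0 mul0n; case: n => [|n] hT; first by rewrite hT quad_mx0.
by case/eqP: cT; apply: suppc; rewrite hT h0.
Qed.

(** Complete the square after multiplying by 4n; for n = 0 the discriminant condition forces r =
    0. *)
Lemma quadratic_form_ge0 (n l r x y : int) : 0 <= n -> 0 <= l ->
  0 <= 4 * n * l - r ^+ 2 -> 0 <= n * x ^+ 2 + r * x * y + l * y ^+ 2.
Proof.
rewrite le_eqVlt => /predU1P[<-|n0] l0 hd.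
  have -> : r = 0.
    apply/eqP; rewrite -sqrf_eq0 eq_le sqr_ge0 andbT.
    by move: hd; rewrite mulr0 mul0r sub0r oppr_ge0.
  by rewrite !mul0r !add0r mulr_ge0 // sqr_ge0.
rewrite -(pmulr_rge0 _ n0) -(pmulr_rge0 _ (ltr0n _ 4 : 0 < 4 :> int)).
rewrite (_ : 4 * _ = (2 * n * x + r * y) ^+ 2 + (4 * n * l - r ^+ 2) * y ^+ 2).
  by rewrite addr_ge0 ?sqr_ge0 // mulr_ge0 // sqr_ge0.
by ring.
Qed.

(** * Integral substitutions on Fourier indices *)

Section Substitution.
Variables (d e : nat) (al be ga de : int).
Hypotheses (d0 : (0 < d)%N) (e0 : (0 < e)%N).
Hypothesis hV : al * de * d%:Z - be * ga * e%:Z = 1.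
Implicit Types (n r m g : int).
Local Notation N := (d * e)%N.
Local Notation tn := (al_n d e al ga).
Local Notation tr := (al_r d e al be ga de).
Local Notation tm := (al_m d e be de).
Local Notation V := (atkin_lehner_mx R N d al be ga de).

(** [d * al_n] is the value of the form at (al d, ga); likewise [e * al_m] below is its value at (be
    e, de). *)
Lemma al_n_ge0 n r m : 0 <= n -> 0 <= m -> 0 <= 4 * n * m * N%:Z - r ^+ 2 ->
  0 <= tn n r m.
Proof.
move=> n0 m0 h; rewrite -(pmulr_rge0 _ (d0 : 0 < d%:Z)).
have hN : 0 <= m * N%:Z by exact: mulr_ge0.
rewrite (_ : _ * _ = n * (al * d%:Z) ^+ 2 + r * (al * d%:Z) * ga + m * N%:Z * ga ^+ 2).
  by apply: quadratic_form_ge0 => //; rewrite mulrA.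
by rewrite /al_n PoszM; ring.
Qed.

Lemma al_m_ge0 n r m : 0 <= n -> 0 <= m -> 0 <= 4 * n * m * N%:Z - r ^+ 2 ->
  0 <= tm n r m.
Proof.
move=> n0 m0 h; rewrite -(pmulr_rge0 _ (e0 : 0 < e%:Z)).
have hN : 0 <= m * N%:Z by exact: mulr_ge0.
rewrite (_ : _ * _ = n * (be * e%:Z) ^+ 2 + r * (be * e%:Z) * de + m * N%:Z * de ^+ 2).
  by apply: quadratic_form_ge0 => //; rewrite mulrA.
by rewrite /al_m PoszM; ring.
Qed.

Lemma quad_bracket (n m : nat) r : 0 <= 4 * n%:Z * m%:Z * N%:Z - r ^+ 2 ->
  exists n' m' : nat, [/\ n'%:Z = tn n r m, m'%:Z = tm n r m &
    bracket (quad_mx R n r (m * N)) V = quad_mx R n' (tr n r m) (m' * N)].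
Proof.
move=> h; exists `|tn n r m|%N, `|tm n r m|%N.
have hn : `|tn n r m|%N%:Z = tn n r m by rewrite gez0_abs //; apply: al_n_ge0 h.
have hm : `|tm n r m|%N%:Z = tm n r m by rewrite gez0_abs //; apply: al_m_ge0 h.
by rewrite !quad_mxE hn hm al_bracket.
Qed.

Lemma fourier_index_bracket (T : 'M[R]_2) : fourier_index N T ->
  fourier_index N (bracket T V).
Proof.
move=> [n [m [r [h ->]]]]; have [n' [m' [hn hm ->]]] := quad_bracket h.
by exists n', m', (tr n r m); rewrite hn hm al_disc.
Qed.

Lemma dvdz_al g n r m : (g %| n)%Z -> (g %| r)%Z -> (g %| m)%Z ->
  [/\ (g %| tn n r m)%Z, (g %| tr n r m)%Z & (g %| tm n r m)%Z].
Proof. by move=> hn hr hm; split; rewrite !rpredD // dvdz_mull. Qed.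

Lemma al_scale g n r m : [/\ tn (g * n) (g * r) (g * m) = g * tn n r m,
  tr (g * n) (g * r) (g * m) = g * tr n r m &
  tm (g * n) (g * r) (g * m) = g * tm n r m].
Proof. by split; rewrite /al_n /al_r /al_m; ring. Qed.

(** Substituting by the adjugate afterwards multiplies the triple by the squared determinant. *)
Lemma alK n r m : let n' := tn n r m in let r' := tr n r m in let m' := tm n r m in
  [/\ al_n d e de (- ga) n' r' m' = n,
      al_r d e de (- be) (- ga) al n' r' m' = r &
      al_m d e (- be) al n' r' m' = m].
Proof.
rewrite /= /al_n /al_r /al_m PoszM.
by split; rewrite -[RHS]mulr1 -[X in _ = _ * X](expr1n _ 2) -[X in _ = _ * X ^+ 2]hV;
  ring.
Qed.

End Substitution.

(** The substitution on triples is integral with integral inverse, so common divisors pass both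
    ways. *)
Lemma al_gcd (d e : nat) (al be ga de r r' : int) (n m n' m' : nat) :
  al * de * d%:Z - be * ga * e%:Z = 1 ->
  n'%:Z = al_n d e al ga n r m -> r' = al_r d e al be ga de n r m ->
  m'%:Z = al_m d e be de n r m ->
  gcdn (gcdn n' `|r'|) m' = gcdn (gcdn n `|r|) m.
Proof.
move=> hV hn hr hm; apply/eqP; rewrite eqn_dvd !dvdn_gcd.
have [kn kr km] := alK hV n r m.
have dvd1 (g n1 m1 : nat) (r1 : int) :
    (g %| gcdn (gcdn n1 `|r1|) m1)%N =
    [&& (g%:Z %| n1%:Z)%Z, (g%:Z %| r1)%Z & (g%:Z %| m1%:Z)%Z].
  by rewrite !dvdn_gcd -andbA.
set g' := gcdn _ m'; set g := gcdn _ m.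
have /and3P[h1 h2 h3] : [&& (g'%:Z %| n'%:Z)%Z, (g'%:Z %| r')%Z & (g'%:Z %| m'%:Z)%Z].
  by rewrite -dvd1.
have /and3P[h4 h5 h6] : [&& (g%:Z %| n%:Z)%Z, (g%:Z %| r)%Z & (g%:Z %| m%:Z)%Z].
  by rewrite -dvd1.
have [i1 i2 i3] := dvdz_al d e de (- be) (- ga) al h1 h2 h3.
have [j1 j2 j3] := dvdz_al d e al be ga de h4 h5 h6.
rewrite -hn -hr -hm in j1 j2 j3 kn kr km.
rewrite kn kr km in i1 i2 i3.
by apply/andP; split; apply/andP; split=> //; apply/andP.
Qed.

End Reduction.

(** * The Maass space *)

Section MaassSpace.
Variable R : realType.
Implicit Types (f : 'M[R[i]]_2 -> R[i]).

Lemma fourier_coef_quad_lt0 N f (n m : nat) (r : int) : (0 < N)%N ->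
  fourier_expansion N f (fourier_coef N f) ->
  ~~ (0 <= 4 * n%:Z * m%:Z * N%:Z - r ^+ 2) ->
  fourier_coef N f (quad_mx R n r (m * N)) = 0.
Proof.
move=> N0 [supp _] h; apply: supp => /(fourier_index_quad N0) h'.
by rewrite h' in h.
Qed.

(* The substitution by [[1, 0]; [lam, 1]] is the case [d = 1] of [V_d]. *)
Lemma fourier_coef_translation N k f (n n' : nat) (r r' : int) : (0 < N)%N ->
  paramodular_form N k f ->
  0 <= 4 * n%:Z * N%:Z - r ^+ 2 ->
  4 * n%:Z * N%:Z - r ^+ 2 = 4 * n'%:Z * N%:Z - r' ^+ 2 ->
  (2 * N%:Z %| r - r')%Z ->
  fourier_coef N f (quad_mx R n r N) = fourier_coef N f (quad_mx R n' r' N).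
Proof.
move=> N0 hf h0 hd /dvdzP[lam hlam]; have [_ _ hex] := hf.
have hV : 1 * 1 * 1%:Z - 0 * lam * N%:Z = 1 by rewrite !mul0r subr0 !mulr1.
have hW : 1 * 1 * 1%:Z - - 0 * - lam * N%:Z = 1 by rewrite oppr0 mul0r mul0r subr0.
have h0' : 0 <= 4 * n%:Z * 1%N%:Z * (1 * N)%N%:Z - r ^+ 2 by rewrite mulr1 mul1n.
have eV : mx2 1 0 lam%:~R 1 = atkin_lehner_mx R (1 * N) 1 1 0 lam 1.
  rewrite atkin_lehnerE sqrtr1 invr1 scale1r; congr mx2; rewrite ?mulr1 //.
  by rewrite mul0r.
have VW := atkin_lehnerK R (ltn0Sn 0) hV.
have iV T := fourier_index_bracket (R := R) (ltn0Sn 0) N0 hV (T := T).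
have iW T := fourier_index_bracket (R := R) (ltn0Sn 0) N0 hW (T := T).
rewrite mul1n in VW iV iW eV h0'.
have [H _] := bracket_invariance 1 N0 hex VW iV iW.
have {}H T : fourier_index N T ->
    fourier_coef N f (bracket T (atkin_lehner_mx R N 1 1 (- 0) (- lam) 1)) =
    fourier_coef N f T.
  rewrite -[RHS]mul1r; apply: H => Z hZ.
  by rewrite -eV mul1r; apply: paramodular_form_translation hf hZ.
have iT : fourier_index N (quad_mx R n r N) by exists n, 1%N, r; rewrite mul1n.
rewrite -(H _ iT).
have h1 : 0 <= 4 * n%:Z * 1%N%:Z * (1 * N)%N%:Z - r ^+ 2 by rewrite mul1n.
have [n1 [m1 [hn1 hm1]]] := quad_bracket R 1 (- 0) (- lam) 1 (ltn0Sn 0) N0 h1.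
rewrite !mul1n => ->.
have {hm1} -> : m1 = 1%N.
  by move: hm1; rewrite /al_m oppr0 expr0n /= !mul0r !add0r expr1n !mul1r => -[].
rewrite mul1n; have hr : al_r 1 N 1 (- 0) (- lam) 1 n r 1%N = r'.
  rewrite /al_r oppr0 (_ : r' = r - lam * (2 * N%:Z)); last by rewrite -hlam; ring.
  by rewrite mul1n; ring.
rewrite hr; congr (fourier_coef _ _ (quad_mx _ _ _ _)).
(* The middle entries now agree, so equal discriminants force equal first entries. *)
have := al_disc hW n r 1%N; rewrite hr -hn1.
rewrite /al_m oppr0 expr0n /= !mul0r !add0r expr1n !mul1r mul1n !mulr1 hd.
have NZ : N%:Z != 0 by rewrite -lt0n.
by move=> /addIr/(mulIf NZ)/(mulfI (isT : (4 : int) != 0)) [].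
Qed.

End MaassSpace.

(** * Passage between the coefficient conditions (ii) and (iii) *)

Section Equivalence.
Variables (R : realType) (d e : nat) (al be ga de : int).
Hypotheses (d0 : (0 < d)%N) (e0 : (0 < e)%N).
Hypothesis hV : al * de * d%:Z - be * ga * e%:Z = 1.
Local Notation N := (d * e)%N.
Local Notation V := (atkin_lehner_mx R N d al be ga de).
Variables (k : int) (f : 'M[R[i]]_2 -> R[i]) (c : R[i]).
Hypothesis hf : maass_space N k f.
Local Notation alpha := (fourier_coef N f).

Let N0 : (0 < N)%N. Proof. by rewrite muln_gt0 d0 e0. Qed.

Let first_column_rule := forall (n n' : nat) (r r' : int),
  4 * n%:Z * N%:Z - r ^+ 2 = 4 * n'%:Z * N%:Z - r' ^+ 2 ->
  (r = - r' %[mod 2 * d%:Z])%Z -> (r = r' %[mod 2 * e%:Z])%Z ->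
  alpha (quad_mx R n r N) = c * alpha (quad_mx R n' r' N).

Lemma maass_bracket_neq0 : first_column_rule -> forall T, fourier_index N T ->
  T != 0 -> alpha (bracket T V) = c * alpha T.
Proof.
move=> hrule _ [n [m [r [hd ->]]]] T0; have [_ hmaass] := hf.
have [n' [m' [hn hm eT]]] := quad_bracket R al be ga de d0 e0 hd.
have T0' : quad_mx R n' (al_r d e al be ga de n r m) (m' * N) != 0.
  rewrite -eT; apply: contra T0 => /eqP h.
  rewrite -[quad_mx _ _ _ _]bracket1 -(atkin_lehnerK R d0 hV) -bracketM h.
  by rewrite /bracket mulmx0 mul0mx.
rewrite eT (hmaass _ _ _ _ T0'); last by rewrite hn hm al_disc.
rewrite (hmaass _ _ _ hd T0) (al_gcd hV hn erefl hm) mulr_sumr.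
apply: eq_big_seq => g; set G := gcdn _ m => hg.
(* The content vanishes only for T = 0; otherwise [divisors] lists exactly its divisors. *)
have G0 : (0 < G)%N.
  rewrite !gcdn_gt0; apply: contraNT T0; rewrite !negb_or -!leqNgt !leqn0 absz_eq0.
  by case/andP => /andP[/eqP-> /eqP->] /eqP->; rewrite mul0n quad_mx0.
have gG : (g %| G)%N by rewrite -dvdn_divisors in hg.
have g0 : (0 < g)%N by apply: dvdn_gt0 gG.
have gZ : g%:Z != 0 by rewrite -lt0n.
have gG' := gG; rewrite /G -(al_gcd hV hn erefl hm) in gG'.
move: gG gG'; rewrite /G !dvdn_gcd => /andP[/andP[/dvdnP[n1 en] gr] /dvdnP[m1 em]].
move=> /andP[/andP[/dvdnP[n1' en'] _] /dvdnP[m1' em']].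
have /dvdzP[r1 er] : (g%:Z %| r)%Z by rewrite dvdzE.
(* By homogeneity the quotients by [g] of the new triple are the substitution applied to (n1, r1,
   m1), so [hrule] compares the two summands of [g]. *)
have [sn sr sm] := al_scale d e al be ga de g%:Z n1 r1 m1.
have en1 : n%:Z = g%:Z * n1 by rewrite en PoszM mulrC.
have em1 : m%:Z = g%:Z * m1 by rewrite em PoszM mulrC.
have er1 : r = g%:Z * r1 by rewrite er mulrC.
rewrite -en1 -em1 -er1 in sn sr sm.
have hn1 : n1'%:Z = al_n d e al ga n1 r1 m1.
  by apply: (mulfI gZ); rewrite -sn -hn en' PoszM mulrC.
have hm1 : m1'%:Z = al_m d e be de n1 r1 m1.
  by apply: (mulfI gZ); rewrite -sm -hm em' PoszM mulrC.
have dv x y : (x * g * (y * g) %/ g ^ 2)%N = (x * y)%N.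
  by rewrite mulnACA mulnn mulnK // expn_gt0 g0.
rewrite sr er1 !(mulrC g%:Z) !mulzK // en em en' em' !dv.
rewrite mulrCA; congr (_ * _); apply: hrule.
- by rewrite !PoszM !(mulrA 4) hn1 hm1 al_disc.
- exact: al_r_modd.
- exact: al_r_mode.
Qed.

(** For T = (n, 0, 0) every Maass summand is a multiple of alpha(0, 0, N). *)
Lemma maass_const0 : k != 0 -> alpha (quad_mx R 0 0 N) = 0 -> alpha 0 = 0.
Proof.
move=> k0 h0; have [hpf hmaass] := hf; apply: (constant_term_eq0 N0 hpf k0) => n n0.
have hT : quad_mx R n 0 (0 * N) != 0.
  by rewrite -quad_mx0; apply/eqP => /quad_mx_inj[h]; rewrite h in n0.
have := hmaass n 0%N 0; rewrite !mulr0 mul0r expr0n subrr => /(_ (lexx _) hT).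
rewrite mul0n => ->; rewrite big1_seq // => g _.
by rewrite muln0 div0n div0z h0 mulr0.
Qed.

Lemma first_column_of_bracket :
  (forall T, fourier_index N T -> alpha (bracket T V) = c * alpha T) ->
  first_column_rule.
Proof.
move=> hT n n' r r' hd hrd hre; have [hpf hmaass] := hf.
have [_ _ /fourier_coefP ef] := hpf.
(* For a negative discriminant neither matrix is a Fourier index, and both coefficients are 0. *)
have [h0|h0] := boolP (0 <= 4 * n%:Z * N%:Z - r ^+ 2); last first.
  have E (n1 : nat) (r1 : int) : ~~ (0 <= 4 * n1%:Z * N%:Z - r1 ^+ 2) ->
      alpha (quad_mx R n1 r1 N) = 0.
    move=> h; rewrite -[X in quad_mx _ _ _ X]mul1n.
    by apply: fourier_coef_quad_lt0 => //; rewrite mulr1.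
  by rewrite (E _ _ h0) E ?mulr0 // -hd.
have h1 : 0 <= 4 * n'%:Z * 1%N%:Z * N%:Z - r' ^+ 2 by rewrite mulr1 -hd.
have [n2 [m2 [hn2 hm2]]] := quad_bracket R al be ga de d0 e0 h1.
set r2 := al_r _ _ _ _ _ _ _ _ _ in hn2 hm2 * => eT.
have iT : fourier_index N (quad_mx R n' r' (1 * N)) by exists n', 1%N, r'.
have := hT _ iT; rewrite eT.
have hd2 : 4 * n2%:Z * m2%:Z * N%:Z - r2 ^+ 2 = 4 * n'%:Z * N%:Z - r' ^+ 2.
  by rewrite hn2 hm2 al_disc // mulr1.
have T0 : quad_mx R n2 r2 (m2 * N) != 0.
  apply/eqP => h; have h' : quad_mx R n' r' (1 * N) = 0.
    rewrite -[quad_mx _ _ _ _]bracket1 -(atkin_lehnerK R d0 hV) -bracketM eT h.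
    by rewrite /bracket mulmx0 mul0mx.
  move: h'; rewrite -quad_mx0 => /quad_mx_inj[_ _ /eqP].
  by rewrite mul1n -leqn0 leqNgt N0.
have h2 : 0 <= 4 * n2%:Z * m2%:Z * N%:Z - r2 ^+ 2 by rewrite hd2 -hd.
(* The content is that of (n', r', 1), namely 1, so the Maass sum has the single term at (n2 m2, r2,
   N). *)
rewrite (hmaass _ _ _ h2 T0).
rewrite (al_gcd hV hn2 erefl hm2) gcdn1 /= big_seq1 divn1 divz1 exp1rz mul1r mul1n.
move=> <-; apply: (fourier_coef_translation N0 hpf h0).
  by rewrite hd -hd2 (PoszM n2) !mulrA.
have hd' : (2 * d%:Z %| r - r2)%Z.
  by rewrite -eqz_mod_dvd; apply/eqP; rewrite hrd /r2 al_r_modd.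
have he' : (2 * e%:Z %| r - r2)%Z.
  by rewrite -eqz_mod_dvd; apply/eqP; rewrite hre /r2 al_r_mode.
case/dvdzP: hd' he' => x ex /dvdzP[y ey]; apply/dvdzP.
(* Chinese remaindering with [hV] as Bezout identity: write r - r2 as 2 e y in the product with al
   de d, and as 2 d x in the product with be ga e. *)
exists (y * al * de - x * be * ga).
rewrite -[LHS]mulr1 -{1}hV mulrBr {1}ey ex PoszM; ring.
Qed.

End Equivalence.

(* [hk] excludes only weight 0 with eps = -1, where a nonzero constant f
   satisfies the third assertion but not the first two. *)
Theorem theorem2 (R : realType) (N d : nat) (hN : squarefree N) (hd : (d %| N)%N)
  (al be ga de : int)
  (hV : al * de * d%:Z - be * ga * (N %/ d)%N%:Z = 1)
  (k eps : int) (heps : eps = 1 \/ eps = -1) (hk : k = 0 -> eps = 1)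
  (f : 'M[R[i]]_2 -> R[i]) (hf : maass_space N k f) :
  let V := atkin_lehner_mx R N d al be ga de in
  let alpha := fourier_coef N f in
  [<-> forall Z, siegel_half_space Z ->
         f (bracket Z (complex_mx V)^T) = eps%:~R * f Z;
       forall T, fourier_index N T ->
         alpha (bracket T (invmx V)) = eps%:~R * alpha T;
       forall (n n' : nat) (r r' : int),
         4 * n%:Z * N%:Z - r ^+ 2 = 4 * n'%:Z * N%:Z - r' ^+ 2 ->
         (r = - r' %[mod 2 * d%:Z])%Z ->
         (r = r' %[mod 2 * (N %/ d)%N%:Z])%Z ->
         alpha (quad_mx R n r N) = eps%:~R * alpha (quad_mx R n' r' N)].
Proof.
(* Zero is not squarefree, being divisible by 2^2. *)
have N0 : (0 < N)%N.
  by rewrite lt0n; apply/eqP => h; have := hN 2%N; rewrite h dvdn0 => /(_ isT).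
have d0 : (0 < d)%N by apply: dvdn_gt0 hd.
have eN : N = (d * (N %/ d))%N by rewrite mulnC divnK.
have e0 : (0 < N %/ d)%N by rewrite divn_gt0 // dvdn_leq.
move: (N %/ d)%N eN e0 hV => e eN e0 hV; subst N; move=> V alpha.
(* The determinant condition for the parameters of the inverse of V, to which the results above are
   applied. *)
have hW : de * al * d%:Z - - be * - ga * e%:Z = 1.
  by rewrite mulrNN -hV; ring.
rewrite (invmx_right (atkin_lehnerK R d0 hV)).
have [[_ _ hex] _] := hf.
have iV T := fourier_index_bracket d0 e0 hV (R := R) (T := T).
have iW T := fourier_index_bracket d0 e0 hW (R := R) (T := T).
have [h12 h21] := bracket_invariance eps%:~R N0 hex (atkin_lehnerK R d0 hV) iV iW.
have [supp _] := fourier_coefP hex.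
tfae=> // [h2 | h3].
  apply: (first_column_of_bracket d0 e0 hW hf) => T.
  exact: h2.
(* The cycle is closed by proving (ii) from (iii), with T = 0 apart since the Maass relation omits
   it. *)
apply: h21 => T iT; have [-> | T0] := eqVneq T 0; last first.
  exact: (maass_bracket_neq0 d0 e0 hW hf h3 iT T0).
rewrite {1}/bracket mulmx0 mul0mx.
case: heps => eps1; first by rewrite eps1 mul1r.
have k0 : k != 0 by apply/eqP => /hk; rewrite eps1.
suff -> : fourier_coef (d * e) f 0 = 0 by rewrite mulr0.
apply: (maass_const0 d0 e0 hf k0).
have := h3 0%N 0%N 0 0 erefl; rewrite oppr0 => /(_ erefl erefl)/eqP.
by rewrite eps1 mulN1r -addr_eq0 -mulr2n mulrn_eq0 => /eqP.
Qed.
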